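(* Let $N$ be a prime power, and select rows indexed by a nonempty set $\mathcal{M}\subseteq\mathbb{Z}_N$ from the $N\times N$ discrete Fourier transform matrix to build the submatrix $\Phi$. Then $\Phi$ is full spark if and only if $\mathcal{M}$ is uniformly distributed over the divisors of $N$.
   Context: The $N\times N$ discrete Fourier transform matrix has entries $\omega^{mn}$, $m,n\in\mathbb{Z}_N$, with $\omega=e^{-2\pi\mathrm{i}/N}$. An $M\times N$ matrix with $N\ge M$ is full spark if every $M\times M$ submatrix (formed by $M$ distinct columns) is invertible. A subset $\mathcal{M}\subseteq\mathbb{Z}_N$ is uniformly distributed over the divisors of $N$ if, for every divisor $d$ of $N$, the $d$ cosets in $\mathbb{Z}_N$ of the subgroup $\langle d\rangle$ generated by $d$ partition $\mathcal{M}$ into subsets each of size $\lfloor\frac{|\mathcal{M}|}{d}\rfloor$ or $\lceil\frac{|\mathcal{M}|}{d}\rceil$. *)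

(* Defs.v *)
From mathcomp Require Import all_boot all_order all_algebra all_fingroup.
From mathcomp Require Import complex archimedean.
From mathcomp Require Import reals sequences exp trigo.

Set Implicit Arguments.
Unset Strict Implicit.
Unset Printing Implicit Defensive.

Import Order.TTheory GRing.Theory Num.Theory.
Local Open Scope ring_scope.
Local Open Scope complex_scope.

Definition cexp (R : realType) (z : R[i]) : R[i] :=
  (expR (complex.Re z))%:C * (cos (complex.Im z) +i* sin (complex.Im z)).

Definition dft_root (R : realType) (N : nat) : R[i] :=
  cexp (0 +i* - (2 * pi / N%:R)).

(* Rows and columns are indexed by 'Z_N, whose underlying ordinal bound is
   (Zp_trunc N).+2; this bound equals N when 1 < N, the only intended case. *)
Definition dft (R : realType) (N : nat) : 'M[R[i]]_((Zp_trunc N).+2) :=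
  \matrix_(m, n) dft_root R N ^+ (m * n)%N.

(* The rows in M appear in the order of enum M; the order of the rows does not
   affect full_spark below. *)
Definition dft_rows (R : realType) (N : nat) (M : {set 'Z_N}) :
    'M[R[i]]_(#|M|, (Zp_trunc N).+2) :=
  rowsub (fun i : 'I_#|M| => enum_val i) (dft R N).

(* An injective f selects m distinct columns. *)
Definition full_spark (F : fieldType) (m n : nat) (A : 'M[F]_(m, n)) : Prop :=
  (m <= n)%N /\
  forall f : 'I_m -> 'I_n, injective f -> colsub f A \in unitmx.

(* <[d%:R]> is the subgroup of the additive group 'Z_N generated by d. *)
Definition unif_distr_divisors (N : nat) (M : {set 'Z_N}) : Prop :=
  forall d : nat, (d %| N)%N ->
  forall C : {set 'Z_N},
    C \in rcosets <[d%:R : 'Z_N]>%g [set: 'Z_N] ->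
    #|M :&: C|%:Z = Num.floor (#|M|%:R / d%:R : rat) \/
    #|M :&: C|%:Z = Num.ceil (#|M|%:R / d%:R : rat).

(* Main.v *)
Require Import Defs.
From mathcomp Require Import all_boot all_order all_algebra all_fingroup.
From mathcomp Require Import complex reals.
From mathcomp Require Import archimedean sequences exp trigo finfield.
From mathcomp Require Import ring lra zify.

(** Write w for the primitive N-th root of unity behind the Fourier matrix, n
    for the number of selected rows, and m_i for their indices.

    Full spark forces uniform distribution by a rank count.  Let d divide N.
    On a coset of the subgroup generated by N/d, the entries of row m depend on
    the column only through a character that is determined by m modulo d.
    Take columns from q such cosets.  If they number at most n, Fourier
    inversion on each coset produces q independent combinations of them that
    vanish outside the rows of a prescribed class modulo d, so that class has
    at least q rows (class_size_ge).  If they number at least n, the rows of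
    one class span at most q dimensions there, so the class has at most q rows
    (class_size_le).  The floor and the ceiling of n/d are the extreme values
    of q.

    Conversely, expand x^m in the Newton basis at the nodes z_j = w^(f j), where
    the f j are the chosen columns.  This factors the minor as det H times a
    product of differences of distinct nodes
    (det_generalized_Vandermonde), where H is made of the Newton coefficients,
    polynomials in the nodes with integer coefficients.  So det H = Q(w) for
    an integer polynomial Q, and Q(1) is the value of det H when all nodes are
    1, namely det C(m_i, k).  For N = p^k, Frobenius gives
    Q(x)^N = Q(x^N) + p W(x), so Q(w) = 0 would make Q(1)/p an algebraic
    integer and hence p would divide Q(1) (prime_power_root_dvd).

    It remains to see that p does not divide det C(m_i, k), which is the
    Vandermonde determinant of the m_i divided by the product of the k!, k < n
    (det_binomial).  The exponent of p in the Vandermonde determinant counts the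
    pairs of rows congruent modulo p^e, over all e.  When class sizes are the
    floor or the ceiling of n/p^e, that count is the sum of the floors of
    k/p^e, k < n, and so matches the formula of Legendre for the k! term by
    term (logn_differences). *)

Set Implicit Arguments.
Unset Strict Implicit.
Unset Printing Implicit Defensive.

Import Order.TTheory GRing.Theory Num.Theory.

(** * Newton interpolation and generalized Vandermonde determinants *)

Section Newton.
Local Open Scope ring_scope.

(** The coefficient of x^m on prod_(l < k) (x - z_l) in the Newton basis, that
    is, the complete homogeneous symmetric polynomial of degree m - k in
    z_0, ..., z_k.  The recursion comes from x = (x - z_k) + z_k. *)
Fixpoint newton_coef (A : comNzRingType) (z : nat -> A) (m k : nat) : A :=
  if m is m'.+1 then
    (if k is k'.+1 then newton_coef z m' k' else 0) + z k * newton_coef z m' k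
  else (k == 0%N)%:R.

Lemma newton_coef_gt (A : comNzRingType) (z : nat -> A) m k :
  (m < k)%N -> newton_coef z m k = 0.
Proof.
elim: m k => [|m IH] [|k] //= lt_mk.
by rewrite !IH ?mulr0 ?addr0 // ltnW.
Qed.

Lemma newton_coef_diag (A : comNzRingType) (z : nat -> A) m :
  newton_coef z m m = 1.
Proof. by elim: m => [|m IH] //=; rewrite IH newton_coef_gt ?mulr0 ?addr0. Qed.

(** When all nodes are 1 the recursion is the triangle of Pascal: the Newton
    expansion becomes the binomial expansion of x^m around 1. *)
Lemma newton_coef1 (A : comNzRingType) m k :
  newton_coef (fun=> 1 : A) m k = 'C(m, k)%:R.
Proof.
elim: m k => [|m IH] [|k] //=; first by rewrite add0r mul1r IH !bin0.
by rewrite !IH mul1r binS natrD addrC.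
Qed.

Lemma rmorph_newton_coef (A B : comNzRingType) (phi : {rmorphism A -> B})
    (z : nat -> A) m k :
  phi (newton_coef z m k) = newton_coef (phi \o z) m k.
Proof.
elim: m k => [|m IH] k /=; first by rewrite rmorph_nat.
by rewrite rmorphD rmorphM IH; case: k => [|k]; rewrite ?rmorph0 ?IH.
Qed.

Lemma eq_newton_coef (A : comNzRingType) (y z : nat -> A) m k :
  y =1 z -> newton_coef y m k = newton_coef z m k.
Proof. by move=> yz; elim: m k => [|m IH] [|k] //=; rewrite !IH yz. Qed.

Lemma newton_expansion (A : comNzRingType) (z : nat -> A) (x : A) m K :
  (m < K)%N ->
  x ^+ m = \sum_(k < K) newton_coef z m k * \prod_(l < k) (x - z l).
Proof.
elim: m K => [|m IH] [|K] // ltmK.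
  rewrite big_ord_recl big_ord0 mulr1 big1 ?addr0 // => i _.
  by rewrite /= mul0r.
under eq_bigr do rewrite /= mulrDl.
rewrite big_split big_ord_recl /= mul0r add0r.
rewrite (big_ord_recr K) /= newton_coef_gt // mulr0 mul0r addr0 -big_split /=.
rewrite exprSr (IH K) // mulr_suml; apply: eq_bigr => k _.
by rewrite big_ord_recr /=; ring.
Qed.

(** At x = z_j the Newton basis polynomials of index k > j vanish, so the
    expansions of all the x^(m_i) need only n basis polynomials, however large
    the m_i are, and the basis evaluated at the nodes is a triangular matrix. *)
Lemma det_generalized_Vandermonde (A : comNzRingType) n (m : 'I_n -> nat)
    (z : nat -> A) :
  \det (\matrix_(i < n, j < n) z j ^+ m i) =
  \det (\matrix_(i < n, k < n) newton_coef z (m i) k) *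
  \prod_(j < n) \prod_(l < j) (z j - z l).
Proof.
pose T : 'M[A]_n := \matrix_(k, j) \prod_(l < k) (z j - z l).
have detT : \det T = \prod_(j < n) \prod_(l < j) (z j - z l).
  rewrite -det_tr det_trig; first by apply: eq_bigr => j _; rewrite !mxE.
  apply/is_trig_mxP => j k lt_jk; rewrite !mxE.
  by rewrite (bigD1 (Ordinal lt_jk)) //= subrr mul0r.
rewrite -detT -det_mulmx; congr (\det _); apply/matrixP => i j.
(* K exceeds both n, to split off the vanishing terms, and m i, to expand. *)
pose K := (n + (m i).+1)%N.
rewrite !mxE (@newton_expansion _ z (z j) (m i) K); last first.
  by rewrite /K addnS ltnS leq_addl.
rewrite big_split_ord /= [X in _ + X]big1 ?addr0 => [|k _].
  by apply: eq_bigr => k _; rewrite !mxE.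
have lt_jk : (j < n + k)%N by rewrite ltn_addr.
by rewrite (bigD1 (Ordinal lt_jk)) //= subrr mul0r mulr0.
Qed.

Lemma natr_ffact (A : comNzRingType) m k :
  (m ^_ k)%:R = \prod_(l < k) (m%:R - l%:R) :> A.
Proof.
elim: k => [|k IH]; first by rewrite big_ord0.
rewrite big_ord_recr -IH /= ffactnSr natrM.
have [le_km|lt_mk] := leqP k m; first by rewrite natrB.
by rewrite ffact_small // !mul0r.
Qed.

(** The falling factorials 'C(x, k) k! are monic of degree k in x, so the
    change of basis L from them to the monomials is unitriangular and leaves
    the Vandermonde determinant unchanged. *)
Lemma det_binomial (A : comNzRingType) n (m : 'I_n -> nat) :
  \det (\matrix_(i < n, k < n) ('C(m i, k)%:R : A)) *
    (\prod_(k < n) k`!)%N%:R =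
  \prod_(i < n) \prod_(j < n | (i < j)%N) ((m j)%:R - (m i)%:R).
Proof.
pose a : 'rV[A]_n := \row_j (m j)%:R.
pose z l : A := l%:R.
pose L : 'M[A]_n := \matrix_(i, k) newton_coef z i k.
pose F : 'M[A]_n := \matrix_(i, k) 'C(m i, k)%:R.
pose D : 'M[A]_n := diag_mx (\row_k (k`!)%:R).
have detL : \det L = 1.
  rewrite det_trig; last first.
    by apply/is_trig_mxP => i j lt_ij; rewrite !mxE newton_coef_gt.
  by rewrite big1 // => i _; rewrite mxE newton_coef_diag.
have detD : \det D = (\prod_(k < n) k`!)%N%:R.
  by rewrite det_diag natr_prod; apply: eq_bigr => k _; rewrite mxE.
have -> : \prod_(i < n) \prod_(j < n | (i < j)%N) ((m j)%:R - (m i)%:R)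
    = \det (Vandermonde n a).
  by rewrite det_Vandermonde; do 2![apply: eq_bigr => ? _]; rewrite !mxE.
have -> : Vandermonde n a = L *m (F *m D)^T.
  apply/matrixP => i j; rewrite !mxE (@newton_expansion _ z _ i n) //.
  apply: eq_bigr => k _; rewrite !mxE -natr_ffact -bin_ffact natrM.
  congr (_ * _); rewrite (bigD1 k) //= big1 ?addr0 => [|l neq_lk].
    by rewrite !mxE eqxx mulr1n.
  by rewrite !mxE (negPf neq_lk) mulr0n mulr0.
by rewrite det_mulmx detL mul1r det_tr det_mulmx detD.
Qed.

End Newton.

(** * Integer polynomials vanishing at a root of unity of prime power order *)

Section Frobenius.
Local Open Scope ring_scope.

(** The Frobenius congruence, with an explicit remainder since it serves in
    characteristic 0. *)
Lemma exprD_prime (A : comNzRingType) (p : nat) (a b : A) :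
  prime p -> exists w, (a + b) ^+ p = a ^+ p + b ^+ p + p%:R * w.
Proof.
case: p => // p p_pr; rewrite exprDn big_ord_recl big_ord_recr /=.
rewrite subn0 expr0 mulr1 bin0 mulr1n subnn expr0 mul1r binn mulr1n.
exists (\sum_(i < p) a ^+ (p - i) * b ^+ i.+1 *+ ('C(p.+1, i.+1) %/ p.+1)).
rewrite mulr_sumr [RHS]addrAC -[RHS]addrA; congr (_ + (_ + _)).
apply: eq_bigr => i _; rewrite mulr_natl -mulrnA divnK //.
by apply: prime_dvd_bin; rewrite ?ltnS /=.
Qed.

Lemma fermat_int (p : nat) (c : int) :
  prime p -> exists t, c ^+ p = c + p%:R * t.
Proof.
move=> p_pr; have charFp := pchar_Fp p_pr.
suff /dvdzP[t def_t] : (p %| c ^+ p - c)%Z.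
  by exists t; rewrite mulrC natz -def_t addrC subrK.
rewrite (dvdz_pcharf charFp) rmorphB rmorphXn /=.
have := expf_card (c%:~R : 'F_p); rewrite (card_Fp p_pr) => ->.
by rewrite subrr.
Qed.

Lemma poly_int_expr_prime (p : nat) (Q : {poly int}) :
  prime p -> exists W, Q ^+ p = Q \Po 'X^p + p%:R * W.
Proof.
move=> p_pr; elim/poly_ind: Q => [|Q c [W defQ]].
  by exists 0; rewrite comp_poly0 mulr0 addr0 expr0n gtn_eqF ?prime_gt0.
have [w ->] := exprD_prime (Q * 'X) c%:P p_pr.
have [t deft] := fermat_int c p_pr.
exists (W * 'X^p + t%:P + w).
rewrite exprMn defQ -polyC_exp deft comp_polyD comp_polyM comp_polyX comp_polyC.
by rewrite !polyCD polyCM [(p%:R)%:P]polyCMn; ring.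
Qed.

Lemma poly_int_expr_prime_power (p k : nat) (Q : {poly int}) :
  prime p -> exists W, Q ^+ (p ^ k) = Q \Po 'X^(p ^ k) + p%:R * W.
Proof.
move=> p_pr; elim: k => [|k [W defW]].
  by exists 0; rewrite mulr0 addr0 expn0 expr1 comp_polyXr.
have [V defV] := poly_int_expr_prime (Q ^+ (p ^ k)) p_pr.
exists (W \Po 'X^p + V).
rewrite expnSr exprM defV {1}defW comp_polyD comp_polyM -comp_polyA.
rewrite rmorph_nat comp_Xn_poly -exprM.
by rewrite mulrDr addrA (mulnC p).
Qed.

(** A rational number that is integral over the integers is an integer: clearing
    the denominators p in an integral equation of y = c/p shows that p divides
    a power of c. *)
Lemma integral_int_dvd (F : numFieldType) (p : nat) (c : int) (y : F) :
    prime p -> integralOver (intr : int -> F) y -> c%:~R = p%:R * y ->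
  (p %| c)%Z.
Proof.
move=> p_pr [g mon_g /rootP gy0] def_c.
have [e def_e] : exists e, size g = e.+1.
  by exists (size g).-1; rewrite prednK // lt0n size_poly_eq0 monic_neq0.
suff : (p %| c ^+ e)%Z by rewrite !dvdzE /= abszX Euclid_dvdX // => /andP[].
have def_ce : c ^+ e = - \sum_(i < e) g`_i * p%:R ^+ (e - i) * c ^+ i.
  apply/eqP; rewrite -addr_eq0 -(intr_eq0 F) rmorphD rmorph_sum /=.
  apply/eqP; transitivity (p%:R ^+ e * (map_poly intr g).[y]); last first.
    by rewrite gy0 mulr0.
  rewrite (@horner_coef_wide _ e.+1); last first.
    by rewrite size_map_poly_id0 ?def_e // intr_eq0 lead_coef_eq0 monic_neq0.
  rewrite mulr_sumr big_ord_recr /= [RHS]addrC; congr (_ + _).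
    have -> : (map_poly intr g)`_e = 1 :> F.
      by move/monicP: mon_g; rewrite lead_coefE def_e coef_map /= => ->.
    by rewrite mul1r rmorphXn /= def_c exprMn.
  apply: eq_bigr => i _; rewrite !rmorphM !rmorphXn /= def_c rmorph_nat exprMn.
  have -> : p%:R ^+ e = p%:R ^+ (e - i) * p%:R ^+ i :> F.
    by rewrite -exprD subnK // ltnW.
  by rewrite coef_map /=; ring.
rewrite def_ce rpredN rpred_sum // => i _.
rewrite -(prednK (_ : 0 < e - i)%N) ?subn_gt0 // exprS.
by rewrite -!mulrA dvdz_mull // natz dvdz_mulr.
Qed.

(** At w, the identity Q^(p^k) = Q(X^(p^k)) + p W reads 0 = Q(1) + p W(w), and
    W(w) is an algebraic integer.  This replaces reduction modulo the prime
    1 - w above p. *)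
Lemma prime_power_root_dvd (F : numFieldType) (p k : nat) (w : F)
    (Q : {poly int}) :
    prime p -> w ^+ (p ^ k) = 1 -> (map_poly intr Q).[w] = 0 ->
  (p %| Q.[1])%Z.
Proof.
move=> p_pr wN1 Qw0; have [W defW] := poly_int_expr_prime_power k Q p_pr.
apply: (@integral_int_dvd F p _ (- (map_poly intr W).[w])) => //.
  apply: integral_opp; apply: integral_horner.
    by apply/integral_poly => i; rewrite coef_map; apply: integral_id.
  have prim_pow : ('X^(p ^ k) - 1 : {poly F}) \is monic.
    by rewrite -polyC1 monicXnsubC // expn_gt0 prime_gt0.
  apply: integral_root_monic prim_pow _ _.
    by rewrite rootE !hornerE wN1 subrr.
  apply/integral_poly => i; rewrite coefB coefXn coef1.
  by apply: integral_sub; apply: integral_nat.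
have /(congr1 (fun P => (map_poly intr P).[w])) := defW.
rewrite /= rmorphXn /= horner_exp Qw0 expr0n expn_eq0 (gtn_eqF (prime_gt0 p_pr)) /=.
rewrite rmorphD rmorphM rmorph_nat /= map_comp_poly rmorphXn /= map_polyX hornerD.
have Q1 : (map_poly intr Q).[1] = (Q.[1])%:~R :> F.
  by rewrite -horner_map /= rmorph1.
rewrite horner_comp hornerXn wN1 Q1.
move/esym/eqP; rewrite addr_eq0 => /eqP ->.
by rewrite hornerM mulrN; congr (- (_ * _)); rewrite -polyC_natr hornerC.
Qed.

End Frobenius.

(** * The exponent of p in a Vandermonde determinant *)

Section Counting.

Definition class_size n (m : 'I_n -> nat) (d r : nat) : nat :=
  #|[set i | m i == r %[mod d]]|.

(** The second value is the ceiling of n / d, written so that the two cases share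
    the quotient n %/ d. *)
Definition equidistributed n (m : 'I_n -> nat) (d : nat) : Prop :=
  forall r, class_size m d r = n %/ d \/
            class_size m d r = n %/ d + ~~ (d %| n).

Lemma class_sizeE n (m : 'I_n -> nat) d r :
  class_size m d r = \sum_(i < n) (m i == r %[mod d]).
Proof. by rewrite /class_size -sum1dep_card big_mkcond. Qed.

Lemma sum_over_classes n (m : 'I_n -> nat) d (F : nat -> nat) : 0 < d ->
  \sum_(i < n) F (m i %% d) = \sum_(r < d) class_size m d r * F r.
Proof.
move=> d_gt0; pose res i : 'I_d := Ordinal (ltn_pmod (m i) d_gt0).
rewrite (partition_big res xpredT) //=; apply: eq_bigr => r _.
rewrite class_sizeE big_distrl big_mkcond /=; apply: eq_bigr => i _.
rewrite -val_eqE /= (modn_small (ltn_ord r)).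
by case: eqP => [->|_]; rewrite ?mul1n.
Qed.

(** The pairs are counted by the sum of the squares of the class sizes c.  Since
    c is q or q + 1, c^2 = (2q + 1) c - q (q + 1), which is affine in c, and the
    class sizes add up to n. *)
Lemma pairs_same_class n (m : 'I_n -> nat) d (q := n %/ d) :
    0 < d -> equidistributed m d ->
  \sum_(i < n) \sum_(j < n) (m i == m j %[mod d]) + d * (q * q.+1) =
  (2 * q).+1 * n.
Proof.
move=> d_gt0 equi.
have -> : \sum_(i < n) \sum_(j < n) (m i == m j %[mod d]) =
    \sum_(r < d) class_size m d r * class_size m d r.
  rewrite -(sum_over_classes _ (class_size m d)) //; apply: eq_bigr => i _.
  by rewrite class_sizeE; apply: eq_bigr => j _; rewrite modn_mod eq_sym.
have sum_n : \sum_(r < d) class_size m d r = n.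
  have := @sum_over_classes n m d (fun=> 1) d_gt0.
  by rewrite sum1_card card_ord; under [RHS]eq_bigr do rewrite muln1.
transitivity ((2 * q).+1 * \sum_(r < d) class_size m d r); last by rewrite sum_n.
rewrite -[X in X * (q * _)](card_ord d) -sum_nat_const -big_split big_distrr /=.
apply: eq_bigr => r _; rewrite -/q in equi; move: (equi r).
by case: (d %| n) => -[] ->; rewrite ?addn0 ?addn1; ring.
Qed.

Lemma sum_divn n d (q := n %/ d) : 0 < d ->
  2 * (\sum_(k < n) k %/ d) + d * (q * q.+1) = 2 * q * n.
Proof.
rewrite {}/q => d_gt0; elim: n => [|n IH]; first by rewrite big_ord0 div0n !muln0.
rewrite big_ord_recr /= divnS //.
have [/dvdnP[t]|_] := boolP (d %| n.+1); last first.
  by rewrite add0n mulnDr addnAC IH mulnS addnC.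
case: t => // t def_n.
have def_q : n %/ d = t.
  have -> : n = t * d + d.-1 by nia.
  by rewrite divnMDl // divn_small ?addn0 // ltn_predL.
by move: IH; rewrite def_q /= add1n; move: (\sum_(k < n) _) => S; nia.
Qed.

(** Passes from ordered pairs, where class sizes are easy to use, to the pairs
    i < j of the Vandermonde product. *)
Lemma sum_symmetric n (F : 'I_n -> 'I_n -> nat) :
    (forall i j, F i j = F j i) ->
  \sum_(i < n) \sum_(j < n) F i j =
  \sum_(i < n) F i i + 2 * \sum_(i < n) \sum_(j < n | i < j) F i j.
Proof.
move=> symF.
have split_row i : \sum_(j < n) F i j =
    F i i + \sum_(j < n | i < j) F i j + \sum_(j < n | j < i) F i j.
  rewrite (bigD1 i) //= (bigID (fun j : 'I_n => i < j)) /= addnA.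
  congr (_ + _ + _); apply: eq_bigl => j.
    by case: eqVneq => [->|]; rewrite ?ltnn.
  by rewrite -leqNgt ltn_neqAle -val_eqE.
rewrite (eq_bigr _ (fun i _ => split_row i)) !big_split /= -addnA mul2n -addnn.
congr (_ + (_ + _)); rewrite (exchange_big_dep xpredT) //=.
by apply: eq_bigr => j _; apply: eq_bigr => i _.
Qed.

(** Both sides are determined by n and d alone: the left one by
    pairs_same_class, the right one by sum_divn. *)
Lemma pairs_lt_same_class n (m : 'I_n -> nat) d :
    0 < d -> equidistributed m d ->
  \sum_(i < n) \sum_(j < n | i < j) (m i == m j %[mod d]) =
  \sum_(k < n) k %/ d.
Proof.
move=> d_gt0 equi; have := pairs_same_class d_gt0 equi.
rewrite sum_symmetric => [|i j]; last by rewrite eq_sym.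
rewrite (eq_bigr (fun=> 1)) => [|i _]; last by rewrite eqxx.
rewrite sum1_card card_ord; have := sum_divn n d_gt0.
move: (\sum_(k < n) _) (\sum_(i < n) _) => S T; nia.
Qed.

(** The bound B is free so that the exponents of all the factors of a product
    become sums over one common range. *)
Lemma logn_count_dvd_wide p x B : prime p -> 0 < x -> x <= B ->
  logn p x = \sum_(1 <= e < B) (p ^ e %| x).
Proof.
move=> p_pr x_gt0 le_xB; rewrite logn_count_dvd // [RHS](big_cat_nat x_gt0 le_xB) /=.
rewrite [X in _ + X]big_nat [X in _ + X]big1 ?addn0 // => e /andP[le_xe _].
apply/eqP; rewrite eqb0; apply/negP => /(dvdn_leq x_gt0).
by apply/negP; rewrite -ltnNge (leq_ltn_trans le_xe) // ltn_expl // prime_gt1.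
Qed.

Lemma logn_fact_wide p x B : prime p -> x < B ->
  logn p x`! = \sum_(1 <= e < B) x %/ p ^ e.
Proof.
move=> p_pr lt_xB; rewrite logn_fact // [RHS](big_cat_nat (ltn0Sn x) lt_xB) /=.
rewrite [X in _ + X]big_nat [X in _ + X]big1 ?addn0 // => e /andP[lt_xe _].
by rewrite divn_small // (ltn_trans lt_xe) // ltn_expl // prime_gt1.
Qed.

Lemma logn_prod (I : Type) (r : seq I) (P : pred I) (F : I -> nat) p :
  (forall i, P i -> 0 < F i) ->
  logn p (\prod_(i <- r | P i) F i) = \sum_(i <- r | P i) logn p (F i).
Proof.
move=> F_gt0; elim: r => [|i r IH]; first by rewrite !big_nil logn1.
rewrite !big_cons; case: ifP => // Pi.
by rewrite lognM ?IH ?F_gt0 ?prodn_cond_gt0.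
Qed.

(** For each e, the pairs congruent modulo p^e are as numerous as the multiples
    of p^e counted by the formula of Legendre for the factorials.  From
    e = k on both counts are zero, as the m_i and the indices i are below p^k. *)
Lemma logn_differences n (m : 'I_n -> nat) p k :
    prime p -> injective m -> (forall i, m i < p ^ k) -> n <= p ^ k ->
    (forall e, e < k -> equidistributed m (p ^ e)) ->
  logn p (\prod_(i < n) \prod_(j < n | i < j) absz ((m j)%:Z - (m i)%:Z)%R) =
  logn p (\prod_(i < n) i`!).
Proof.
move=> p_pr inj_m lt_m le_n equi; pose B := p ^ k.
have diff_gt0 (i j : 'I_n) : i < j -> 0 < absz ((m j)%:Z - (m i)%:Z)%R.
  move=> lt_ij; rewrite absz_gt0 subr_eq0 eqz_nat.
  by apply: contraTneq lt_ij => /inj_m ->; rewrite ltnn.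
rewrite logn_prod => [|i _]; last by rewrite prodn_cond_gt0 // => j /diff_gt0.
rewrite [RHS]logn_prod => [|i _]; last exact: fact_gt0.
transitivity (\sum_(i < n) \sum_(j < n | i < j)
    \sum_(1 <= e < B) (m i == m j %[mod p ^ e])).
  apply: eq_bigr => i _; rewrite logn_prod => [|j]; last exact: diff_gt0.
  apply: eq_bigr => j lt_ij; rewrite (@logn_count_dvd_wide p _ B) ?diff_gt0 //.
    apply: eq_bigr => e _; congr nat_of_bool.
    have := eqz_mod_dvd (p ^ e)%N (m j) (m i).
    by rewrite !modz_nat eqz_nat eq_sym dvdzE /= => ->.
  by have := lt_m i; have := lt_m j; rewrite /B; lia.
transitivity (\sum_(1 <= e < B)
    \sum_(i < n) \sum_(j < n | i < j) (m i == m j %[mod p ^ e])).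
  rewrite [RHS]exchange_big; apply: eq_bigr => i _; exact: exchange_big.
transitivity (\sum_(1 <= e < B) \sum_(i < n) i %/ p ^ e); last first.
  rewrite exchange_big; apply: eq_bigr => i _.
  by rewrite (@logn_fact_wide p i B) // (leq_trans (ltn_ord i)).
apply: eq_bigr => e _.
have [lt_ek|le_ke] := ltnP e k.
  by rewrite pairs_lt_same_class ?expn_gt0 ?prime_gt0 //; apply: equi.
have le_B : p ^ k <= p ^ e by rewrite leq_exp2l ?prime_gt1.
rewrite big1 => [|i _]; last first.
  rewrite big1 // => j lt_ij; rewrite !modn_small ?(leq_trans (lt_m _)) //.
  by apply/eqP; rewrite eqb0; apply: contraTneq lt_ij => /inj_m ->; rewrite ltnn.
by rewrite big1 // => i _; rewrite divn_small //
  (leq_trans (ltn_ord i)) // (leq_trans le_n).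
Qed.

(** The determinant is a quotient of two integers with the same exponent of p. *)
Lemma equidistributed_det_binomial n (m : 'I_n -> nat) p k :
    prime p -> injective m -> (forall i, m i < p ^ k) -> n <= p ^ k ->
    (forall e, e < k -> equidistributed m (p ^ e)) ->
  ~~ (p %| (\det (\matrix_(i < n, j < n) ('C(m i, j)%:R : int)))%R)%Z.
Proof.
move=> p_pr inj_m lt_m le_n equi; have := det_binomial int m.
set D := (\det _)%R => /(congr1 absz); rewrite abszM natz absz_nat.
set V := (X in _ = absz X).
have -> : `|V|%N = \prod_(i < n) \prod_(j < n | i < j) absz ((m j)%:Z - (m i)%:Z)%R.
  rewrite /V (big_morph absz abszM (erefl _ : absz 1 = 1)); apply: eq_bigr => i _.
  by rewrite (big_morph absz abszM (erefl _ : absz 1 = 1));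
     apply: eq_bigr => j _; rewrite !natz.
set W := (\prod_(i < n) \prod_(j < n | _) _)%N => def_W.
have W_gt0 : 0 < W.
  apply: prodn_gt0 => i; apply: prodn_cond_gt0 => j lt_ij.
  rewrite absz_gt0 subr_eq0 eqz_nat.
  by apply: contraTneq lt_ij => /inj_m ->; rewrite ltnn.
have D_gt0 : 0 < `|D|%N by move: W_gt0; rewrite -def_W muln_gt0 => /andP[].
have := logn_differences p_pr inj_m lt_m le_n equi; rewrite -/W -def_W.
rewrite lognM //; last by apply: prodn_gt0 => i; apply: fact_gt0.
rewrite dvdzE /= -[X in X %| _]expn1 pfactor_dvdn // -ltnNge; lia.
Qed.

End Counting.

(** * Equidistributed rows give invertible minors *)

Section Sufficiency.
Local Open Scope ring_scope.

Lemma equidistributed_unitmx (F : numFieldType) n p k (w : F)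
    (m f : 'I_n -> nat) :
    prime p -> (p ^ k)%N.-primitive_root w ->
    injective m -> (forall i, m i < p ^ k)%N ->
    injective f -> (forall j, f j < p ^ k)%N -> (n <= p ^ k)%N ->
    (forall e, (e < k)%N -> equidistributed m (p ^ e)%N) ->
  \matrix_(i < n, j < n) w ^+ (m i * f j) \in unitmx.
Proof.
move=> p_pr prim_w inj_m lt_m inj_f lt_f le_n equi.
(* newton_coef takes a sequence of nodes indexed by nat; only its values
   below n, the chosen columns, enter the matrices. *)
pose e l := if insub l is Some j then f j else 0%N.
have eE (j : 'I_n) : e j = f j by rewrite /e valK.
(* Powers of an indeterminate as nodes: evaluating at w gives the minor, at 1
   the binomial determinant. *)
pose G : 'M[{poly int}]_n :=
  \matrix_(i, j) newton_coef (fun l => 'X^(e l)) (m i) j.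
pose ev : {rmorphism {poly int} -> F} := horner_eval w \o map_poly intr.
have evG : map_mx ev G = \matrix_(i, j) newton_coef (fun l => w ^+ e l) (m i) j.
  apply/matrixP => i j; rewrite !mxE rmorph_newton_coef.
  apply: eq_newton_coef => l.
  by rewrite /= /horner_eval map_polyXn hornerXn.
have G1 : (\det G).[1] = \det (\matrix_(i < n, j < n) ('C(m i, j)%:R : int)).
  rewrite -horner_evalE -det_map_mx; congr (\det _); apply/matrixP => i j.
  rewrite !mxE rmorph_newton_coef -newton_coef1; apply: eq_newton_coef => l.
  by rewrite /= /horner_eval hornerXn expr1n.
have ev_neq0 : ev (\det G) != 0.
  apply: contraNneq (equidistributed_det_binomial p_pr inj_m lt_m le_n equi).
  by move=> evG0; rewrite -G1 (prime_power_root_dvd p_pr (prim_expr_order prim_w)).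
have -> : \matrix_(i < n, j < n) w ^+ (m i * f j) =
    \matrix_(i < n, j < n) (w ^+ e j) ^+ m i.
  by apply/matrixP => i j; rewrite !mxE eE -exprM mulnC.
rewrite unitmxE unitfE (det_generalized_Vandermonde m (fun l => w ^+ e l)).
rewrite -evG det_map_mx mulf_neq0 //.
apply/prodf_neq0 => j _; apply/prodf_neq0 => l _.
have lt_ln : (l < n)%N := ltn_trans (ltn_ord l) (ltn_ord j).
rewrite subr_eq0 eE -[l : nat]/(nat_of_ord (Ordinal lt_ln)) eE.
rewrite (eq_prim_root_expr prim_w) !modn_small //.
apply/eqP => /inj_f /(congr1 val) /= def_l.
by have := ltn_ord l; rewrite -def_l ltnn.
Qed.

End Sufficiency.

(** * Invertible minors give equidistributed rows *)

Section Necessity.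
Local Open Scope ring_scope.

(** Lists the columns coset by coset for the subgroup generated by N/d: the index
    i is placed in the coset of i %/ d, at its element of rank i %% d.  So the
    first q d columns in this order are the cosets of 0, ..., q - 1, and the
    same choice of n columns serves both rank bounds. *)
Definition coset_column (N d i : nat) : nat := (i %/ d + N %/ d * (i %% d))%N.

Lemma coset_column_lt N d i :
  (d %| N)%N -> (i < N)%N -> (coset_column N d i < N)%N.
Proof.
move=> /dvdnP[e ->] lt_iN.
have d_gt0 : (0 < d)%N by rewrite lt0n; apply: contraTneq lt_iN => ->; rewrite muln0.
rewrite /coset_column mulnK //; have := ltn_pmod i d_gt0.
have : (i %/ d < e)%N by rewrite ltn_divLR.
nia.
Qed.

Lemma coset_column_inj N d i j : (d %| N)%N -> (i < N)%N -> (j < N)%N ->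
  coset_column N d i = coset_column N d j -> i = j.
Proof.
move=> /dvdnP[e ->] lt_iN lt_jN.
have d_gt0 : (0 < d)%N by rewrite lt0n; apply: contraTneq lt_iN => ->; rewrite muln0.
rewrite /coset_column mulnK // => eq_ij.
have lt_i : (i %/ d < e)%N by rewrite ltn_divLR.
have lt_j : (j %/ d < e)%N by rewrite ltn_divLR.
have e_gt0 : (0 < e)%N by apply: leq_ltn_trans lt_i.
rewrite (divn_eq i d) (divn_eq j d); congr (_ * _ + _)%N.
  have := congr1 (modn^~ e) eq_ij.
  by rewrite !(addnC (_ %/ _)%N) ![(e * _)%N]mulnC !modnMDl !modn_small.
have := congr1 (divn^~ e) eq_ij.
by rewrite !(addnC (_ %/ _)%N) ![(e * _)%N]mulnC !divnMDl //
  (divn_small lt_i) (divn_small lt_j) !addn0.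
Qed.

Lemma rank_row_support (F : fieldType) n q (X : 'M[F]_(n, q)) (T : {set 'I_n}) :
  (forall i j, i \notin T -> X i j = 0) -> (\rank X <= #|T|)%N.
Proof.
move=> X0.
pose S : 'M[F]_(n, #|T|) := \matrix_(i, u) (i == enum_val u)%:R.
have -> : X = S *m rowsub enum_val X.
  apply/matrixP => i j; rewrite mxE.
  under eq_bigr do rewrite !mxE.
  rewrite -(big_enum_val (fun l => (i == l)%:R * X l j)) /=.
  have [iT|iT] := boolP (i \in T).
    rewrite (bigD1 i) //= eqxx mul1r big1 ?addr0 // => l /andP[_ neq_li].
    by rewrite eq_sym (negPf neq_li) mul0r.
  rewrite X0 // big1 // => l lT; case: eqP => [eq_il|_]; last by rewrite mul0r.
  by rewrite eq_il lT in iT.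
exact: mulmx_max_rank.
Qed.

(** The entry of row m splits into a factor constant on the coset and the value
    of a character of the coset, which depends on m modulo d only because
    w^(N/d) has order d. *)
Lemma coset_columns_exp (F : fieldType) (w : F) N d m i :
  w ^+ (m * coset_column N d i) =
  w ^+ (m * (i %/ d)) * (w ^+ (N %/ d)) ^+ m ^+ (i %% d).
Proof. by rewrite /coset_column mulnDr exprD -!exprM mulnA mulnCA mulnA. Qed.

(** Restricted to one class modulo d, the character factor is common to all
    rows, so these rows factor through the q cosets that contain the columns;
    they are independent, as rows of an invertible matrix. *)
Lemma class_size_le (F : fieldType) n N d q (w : F) (m : 'I_n -> nat) r :
    N.-primitive_root w -> (d %| N)%N -> (n <= q * d)%N ->
    \matrix_(i < n, j < n) w ^+ (m i * coset_column N d j) \in unitmx ->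
  (class_size m d r <= q)%N.
Proof.
move=> prim_w dvd_dN le_n; set A := \matrix_(i, j) _ => unitA.
pose T := [set i | m i == r %[mod d]].
pose z := w ^+ (N %/ d).
have prim_z : d.-primitive_root z by apply: dvdn_prim_root.
have d_gt0 := prim_order_gt0 prim_z.
pose P : 'M[F]_(#|T|, q) := \matrix_(u, s) w ^+ (m (enum_val u) * s).
pose Q : 'M[F]_(q, n) := \matrix_(s, j) ((j %/ d == s)%N%:R * z ^+ r ^+ (j %% d)).
have defA : rowsub enum_val A = P *m Q.
  apply/matrixP => u j; rewrite !mxE coset_columns_exp -/z.
  have lt_jq : (j %/ d < q)%N.
    by rewrite ltn_divLR // (leq_trans (ltn_ord j)).
  rewrite (bigD1 (Ordinal lt_jq)) //= big1 ?addr0 => [|s neq_s].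
    rewrite !mxE eqxx mul1r; congr (_ * _ ^+ _); apply/eqP.
    by rewrite (eq_prim_root_expr prim_z); have := enum_valP u; rewrite inE.
  by rewrite !mxE eq_sym; case: eqP => [eq_s|_]; rewrite ?mul0r ?mulr0 //;
     case/eqP: neq_s; apply: val_inj.
have id_factor : P *m (Q *m colsub enum_val (invmx A)) = 1%:M.
  rewrite mulmxA -defA mulmx_colsub mul_rowsub_mx mulmxV //.
  by apply/matrixP => u v; rewrite !mxE (inj_eq enum_val_inj).
by rewrite -[X in (X <= _)%N](mxrank1 F) -/T -id_factor mulmx_max_rank.
Qed.

(** The columns of E are the conjugate character of the class of r on each of
    the q cosets: A *m E has rank q, and its rows outside the class of r vanish
    by orthogonality of characters. *)
Lemma class_size_ge (F : fieldType) n N d q (w : F) (m : 'I_n -> nat) r :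
    N.-primitive_root w -> (d %| N)%N -> (q * d <= n)%N ->
    \matrix_(i < n, j < n) w ^+ (m i * coset_column N d j) \in unitmx ->
  (q <= class_size m d r)%N.
Proof.
move=> prim_w dvd_dN le_n; set A := \matrix_(i, j) _ => unitA.
pose z := w ^+ (N %/ d).
have prim_z : d.-primitive_root z by apply: dvdn_prim_root.
have d_gt0 := prim_order_gt0 prim_z.
have zr_neq0 : z ^+ r != 0.
  by rewrite expf_neq0 // (prim_root_eq0 prim_z) -lt0n.
have lt_col (s : 'I_q) (t : 'I_d) : (s * d + t < n)%N.
  have := ltn_ord s; have := ltn_ord t; nia.
pose E : 'M[F]_(n, q) := \matrix_(j, s) ((j %/ d == s)%N%:R / z ^+ r ^+ (j %% d)).
have rankAE : (\rank (A *m E) <= class_size m d r)%N.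
  apply: rank_row_support => i s; rewrite inE => neq_ir.
  (* The character sum over a coset is a geometric sum of ratio x, and x is a
     d-th root of unity other than 1 since m i and r differ modulo d. *)
  pose x := z ^+ m i / z ^+ r.
  have sum_x : \sum_(t < d) x ^+ t = 0.
    apply/eqP; have := subrX1 x d.
    rewrite expr_div_n -!exprM ![(_ * d)%N]mulnC !exprM (prim_expr_order prim_z).
    rewrite !expr1n divr1 subrr => /esym/eqP; rewrite mulf_eq0 => /orP[|//].
    by rewrite subr_eq0 -(inj_eq (mulIf zr_neq0)) divfK // mul1r
      (eq_prim_root_expr prim_z) (negPf neq_ir).
  rewrite mxE (bigID (fun j : 'I_n => j %/ d == s)%N) /= addrC big1 ?add0r.
    rewrite (reindex_onto (fun t => Ordinal (lt_col s t))
      (fun j : 'I_n => Ordinal (ltn_pmod j d_gt0))) /=; last first.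
      by move=> j /eqP eq_js; apply: val_inj; rewrite /= -eq_js -divn_eq.
    have colE (t : 'I_d) : ((s * d + t) %/ d = s)%N * ((s * d + t) %% d = t)%N.
      by rewrite divnMDl // modnMDl divn_small ?modn_small ?addn0.
    under eq_bigl => t.
      rewrite !colE eqxx /= (_ : _ == t); last by rewrite -val_eqE /= colE.
      over.
    transitivity (w ^+ (m i * s) * \sum_(t < d) x ^+ t); last first.
      by rewrite sum_x mulr0.
    rewrite mulr_sumr; apply: eq_bigr => t _.
    rewrite !mxE coset_columns_exp !colE eqxx /= -/z mul1r -mulrA.
    by rewrite expr_div_n.
  by move=> j /negPf neq_js; rewrite !mxE neq_js mul0r mulr0.
(* The first column of each coset, where the character is 1. *)
pose h (s : 'I_q) : 'I_n := Ordinal (lt_col s (Ordinal d_gt0)).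
have id_factor : rowsub h (invmx A) *m (A *m E) = 1%:M.
  rewrite mulmxA mul_rowsub_mx mulVmx // mul_rowsub_mx mul1mx.
  apply/matrixP => s s'; rewrite !mxE /= addn0 mulnK // modnMl.
  by rewrite expr0 divr1.
rewrite -[X in (X <= _)%N](mxrank1 F) -id_factor.
exact: leq_trans (mxrankM_maxr _ _) rankAE.
Qed.

Lemma unitmx_equidistributed (F : fieldType) n N d (w : F) (m : 'I_n -> nat) :
    N.-primitive_root w -> (d %| N)%N ->
    \matrix_(i < n, j < n) w ^+ (m i * coset_column N d j) \in unitmx ->
  equidistributed m d.
Proof.
move=> prim_w dvd_dN unitA r.
have d_gt0 := dvdn_gt0 (prim_order_gt0 prim_w) dvd_dN.
have lo := class_size_ge r prim_w dvd_dN (leq_trunc_div n d) unitA.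
have hi : (class_size m d r <= n %/ d + ~~ (d %| n))%N.
  apply: class_size_le prim_w dvd_dN _ unitA.
  have [dvd_dn|_] := boolP (d %| n)%N; first by rewrite addn0 divnK.
  by rewrite addn1 ltnW // ltn_ceil.
by move: lo hi; case: (~~ _); lia.
Qed.

End Necessity.

(** * The Fourier matrix and the cosets of Z_N *)

Section Fourier.
Local Open Scope ring_scope.
Local Open Scope complex_scope.

Lemma cis_exp (R : realType) (t : R) n :
  (cos t +i* sin t) ^+ n = cos (t *+ n) +i* sin (t *+ n).
Proof.
elim: n => [|n IH]; first by rewrite mulr0n cos0 sin0 expr0.
rewrite exprS IH mulrS cosD sinD; apply/eqP; rewrite eq_complex /=.
by rewrite eqxx /= addrC eqxx.
Qed.

(** For 0 < a < N, cos (2 pi a / N) = 1 - 2 sin^2 (pi a / N) < 1, because the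
    angle pi a / N lies strictly between 0 and pi. *)
Lemma dft_root_prim (R : realType) N :
  (0 < N)%N -> N.-primitive_root (dft_root R N).
Proof.
move=> N_gt0; pose t : R := pi / N%:R.
have N_neq0 : N%:R != 0 :> R by rewrite pnatr_eq0 -lt0n.
have rootE a : dft_root R N ^+ a =
    cos (t *+ a *+ 2) +i* - sin (t *+ a *+ 2).
  rewrite /dft_root /cexp /= expR0 mul1r cis_exp -cosN -sinN.
  have -> : - (2 * pi / N%:R) *+ a = - (t *+ a *+ 2).
    by rewrite mulNrn /t -mulrA mulr_natl mulrnAC.
  by rewrite opprK.
apply/andP; split=> //; apply/forallP => i; rewrite unity_rootE rootE.
apply/eqP; have [->|neq_iN] := eqVneq i.+1 N.
  have -> : t *+ N = pi by rewrite -[LHS]mulr_natr divfK.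
  by rewrite cos2pi sin2pi oppr0 eqxx.
apply/negbTE; rewrite eq_complex /= negb_and; apply/orP; left.
have lt_iN : (i.+1 < N)%N by rewrite ltn_neqAle neq_iN ltn_ord.
have sin_pos : 0 < sin (t *+ i.+1).
  have t_gt0 : 0 < t by rewrite divr_gt0 ?pi_gt0 ?ltr0n.
  apply: sin_gt0_pi; rewrite pmulrn_lgt0 // t_gt0 /=.
  have <- : t *+ N = pi by rewrite -[LHS]mulr_natr divfK.
  by rewrite ltr_pMn2l.
rewrite cos_mulr2n; have := cos2Dsin2 (t *+ i.+1).
have : 0 < sin (t *+ i.+1) ^+ 2 by rewrite exprn_gt0.
by move=> s2 cs; rewrite lt_eqF //; lra.
Qed.

Lemma floor_divn n d : (0 < d)%N ->
  Num.floor (n%:R / d%:R : rat) = (n %/ d)%N%:Z.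
Proof.
move=> d_gt0; apply: floor_def; have dQ : 0 < d%:R :> rat by rewrite ltr0n.
rewrite ler_pdivlMr // ltr_pdivrMr // -PoszD -!pmulrn -!natrM ler_nat ltr_nat.
by rewrite leq_trunc_div addn1 ltn_ceil.
Qed.

Lemma ceil_divn n d : (0 < d)%N ->
  Num.ceil (n%:R / d%:R : rat) = (n %/ d + ~~ (d %| n))%N%:Z.
Proof.
move=> d_gt0; apply: ceil_def; have dQ : 0 < d%:R :> rat by rewrite ltr0n.
rewrite ltr_pdivlMr // ler_pdivrMr // rmorphB /= -!pmulrn mulrBl mul1r.
rewrite ltrBlDr -!natrM -natrD ltr_nat ler_nat.
have := divn_eq n d; have := ltn_pmod n d_gt0; rewrite /dvdn.
by move: (n %/ d)%N (n %% d)%N => q [|r] /=; nia.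
Qed.

Lemma mem_cycle_Zp N d (u : 'Z_N) :
  (1 < N)%N -> (d %| N)%N -> (u \in <[d%:R : 'Z_N]>%g) = (d %| u)%N.
Proof.
move=> N_gt1 dvd_dN; apply/cycleP/idP => [[i ->]|/dvdnP[t def_u]].
  rewrite Zp_expg /= val_Zp_nat // [X in (_ %% X)%N]Zp_cast // modnMml.
  by rewrite /dvdn modn_dvdm // modnMr.
exists t; apply: val_inj; rewrite Zp_expg /= val_Zp_nat //.
rewrite [X in (_ %% X)%N]Zp_cast // modnMml mulnC -def_u modn_small //.
by rewrite -[X in (_ < X)%N]Zp_cast.
Qed.

Lemma mem_rcoset_Zp N d (x y : 'Z_N) : (1 < N)%N -> (d %| N)%N ->
  (y \in <[d%:R : 'Z_N]> :* x)%g = (y == x %[mod d])%N.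
Proof.
move=> N_gt1 dvd_dN; rewrite mem_rcoset mem_cycle_Zp //.
have lt_xN : (x < N)%N by rewrite -[X in (_ < X)%N]Zp_cast.
have -> : val (y * x^-1)%g = ((y + (N - x)) %% N)%N.
  rewrite /=; move: (nat_of_ord y) (nat_of_ord x) => a b.
  by rewrite Zp_cast // modnDmr.
rewrite /dvdn modn_dvdm // -[RHS](eqn_modDr (N - x)) subnKC ?(ltnW lt_xN) //.
by rewrite (eqP dvd_dN).
Qed.

Lemma card_setI_coset N d r (M C : {set 'Z_N}) :
    (forall y, (y \in C) = (y == r %[mod d])%N) ->
  #|M :&: C| = class_size (fun i : 'I_#|M| => enum_val i : nat) d r.
Proof.
move=> memC; rewrite class_sizeE.
rewrite -(big_enum_val (fun y : 'Z_N => (y == r %[mod d] : nat)%N)) /=.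
rewrite -big_mkcondr sum1_card; apply: eq_card => y.
by rewrite !inE memC.
Qed.

(** The cosets of the subgroup generated by d are the residue classes modulo d,
    because d divides N. *)
Lemma unif_distr_divisorsP N (M : {set 'Z_N}) : (1 < N)%N ->
  unif_distr_divisors M <->
  forall d, (d %| N)%N ->
    equidistributed (fun i : 'I_#|M| => enum_val i : nat) d.
Proof.
move=> N_gt1; have N_gt0 := ltnW N_gt1; split=> [unif d dvd_dN r|equi d dvd_dN C].
  have d_gt0 := dvdn_gt0 N_gt0 dvd_dN.
  have memC (y : 'Z_N) :
      (y \in <[d%:R : 'Z_N]> :* (r%:R : 'Z_N))%g = (y == r %[mod d])%N.
    by rewrite mem_rcoset_Zp // val_Zp_nat // modn_dvdm.
  have : (<[d%:R : 'Z_N]> :* (r%:R : 'Z_N) \in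
      rcosets <[d%:R : 'Z_N]> [set: 'Z_N])%g.
    by apply/rcosetsP; exists (r%:R : 'Z_N); rewrite ?inE.
  move/(unif d dvd_dN); rewrite floor_divn // ceil_divn // (card_setI_coset M memC).
  by case=> /eqP; rewrite eqz_nat => /eqP; [left|right].
have d_gt0 := dvdn_gt0 N_gt0 dvd_dN.
case/rcosetsP => x _ ->; rewrite floor_divn // ceil_divn //.
rewrite (card_setI_coset M (fun y => mem_rcoset_Zp x y N_gt1 dvd_dN)).
by case: (equi d dvd_dN x) => ->; [left|right].
Qed.

End Fourier.

Theorem theorem19 (R : realType) (N p k : nat) (hp : prime p) (hk : 0 < k)
    (hN : N = p ^ k) (M : {set 'Z_N}) (hM : M != set0) :
  full_spark (dft_rows R M) <-> unif_distr_divisors M.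
Proof.
have N_gt1 : 1 < N by rewrite hN -(exp1n k) ltn_exp2r ?prime_gt1.
have castN : (Zp_trunc N).+2 = N := Zp_cast N_gt1.
have prim_w := dft_root_prim R (ltnW N_gt1).
have le_MN : #|M| <= N.
  by rewrite -[X in _ <= X]castN -[X in _ <= X]card_ord max_card.
pose m (i : 'I_#|M|) : nat := enum_val i.
have dftE (f : 'I_#|M| -> 'I_(Zp_trunc N).+2) :
    (colsub f (dft_rows R M) =
     \matrix_(i, j) dft_root R N ^+ (m i * f j))%R.
  by apply/matrixP => i j; rewrite !mxE.
rewrite unif_distr_divisorsP //; split=> [[_ spark] d dvd_dN|equi].
  have lt_col (j : 'I_#|M|) : coset_column N d j < (Zp_trunc N).+2.
    by rewrite [X in _ < X]castN coset_column_lt // (leq_trans (ltn_ord j)).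
  apply: (unitmx_equidistributed prim_w dvd_dN).
  have := spark (fun j => Ordinal (lt_col j)); rewrite dftE; apply => i j.
  move=> /(congr1 val) /= eq_ij; apply: val_inj.
  by apply: coset_column_inj dvd_dN _ _ eq_ij; rewrite (leq_trans (ltn_ord _)).
split=> [|f inj_f]; first by rewrite [X in _ <= X]castN.
have lt_N (u : 'Z_N) : u < p ^ k by rewrite -hN -[X in _ < X]castN.
rewrite dftE; apply: (@equidistributed_unitmx _ _ p k) => //.
- by rewrite -hN.
- by move=> i j /val_inj /enum_val_inj.
- by move=> i; apply: lt_N.
- by move=> i j /val_inj /inj_f.
- by rewrite -hN.
- by move=> e lt_ek; apply: equi; rewrite hN dvdn_exp2l // ltnW.
Qed.
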